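(* For any Borel measures $\mu$ and $\eta$ on a common metric space $Z$, \[ d_I(\mathcal B(\mu),\mathcal B(\eta))\le d_{Pr}(\mu,\eta), \] where $\mathcal B(\mu)$ and $\mathcal B(\eta)$ are the measure bifiltrations.
   Context: $B(y,r)$ is the open ball of radius $r$ about $y$. $J=(0,\infty)^{\mathrm{op}}\times(0,\infty)$, so $(k,r)\le(k',r')$ iff $k\ge k'$ and $r\le r'$. For a Borel measure $\mu$ on a metric space $Z$, the measure bifiltration is the functor $\mathcal B(\mu):J\to\mathbf{Top}$, $\mathcal B(\mu)_{(k,r)}=\{y\in Z\mid\mu(B(y,r))\ge k\}$, with internal maps the inclusions. The Prohorov distance is \[ d_{Pr}(\mu,\eta)=\sup_A\inf\{\delta\ge 0 \mid \mu(A)\le\eta(A^\delta)+\delta \text{ and } \eta(A)\le\mu(A^\delta)+\delta\}, \] where $A\subset Z$ ranges over closed sets and $A^\delta$ is the set of points of $Z$ at distance $<\delta$ from some $a\in A$ (the value may be $\infty$). Let $\tau^\delta(x,y)=(x-\delta,y+\delta)$ on $\mathbb R^{\mathrm{op}}\times\mathbb R$, $\delta\ge0$ (ordered by $(a,b)\le(c,d)$ iff $a\ge c$ and $b\le d$). The thin category $\mathbf I^{\delta}$ has objects $J\times\{0,1\}$ and a morphism $(r,i)\to(s,j)$ iff either $i=j$ and $r\le s$, or $i\ne j$ and $\tau^\delta(r)\le s$. Functors $F,G:J\to\mathbf{Top}$ are $\delta$-interleaved if there is a functor $\mathbf I^{\delta}\to\mathbf{Top}$ restricting to $F$ on $J\times\{0\}$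 and to $G$ on $J\times\{1\}$; $d_I(F,G)=\inf\{\delta\mid F,G\text{ are }\delta\text{-interleaved}\}\in[0,\infty]$. *)

(* Defs.v *)
From HB Require Import structures.
From mathcomp Require Import all_boot all_order all_algebra.
From mathcomp Require Import all_classical all_reals all_analysis.
From mathcomp Require Import lra.

Set Implicit Arguments.
Unset Strict Implicit.
Unset Printing Implicit Defensive.

Import Order.TTheory GRing.Theory Num.Theory.
Import numFieldNormedType.Exports.

Local Open Scope classical_set_scope.
Local Open Scope ring_scope.

(* Functors from a preorder, viewed as a thin category, to Top. Proofs of     *)
(* [x <= y] are equalities of booleans, hence unique, so [tmap] gives exactly *)
(* one map per morphism, and quantifying over [xz] loses nothing.             *)
Record topFunctor d (P : preorderType d) := TopFunctor {
  tobj :> P -> topologicalType ;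
  tmap : forall x y : P, (x <= y)%O -> continuousType (tobj x) (tobj y) ;
  tmap_id : forall (x : P) (xx : (x <= x)%O), tmap xx =1 idfun ;
  tmap_comp : forall (x y z : P)
    (xy : (x <= y)%O) (yz : (y <= z)%O) (xz : (x <= z)%O),
    tmap xz =1 tmap yz \o tmap xy
}.

Definition precomp d d' (P : preorderType d) (Q : preorderType d')
    (f : P -> Q) (fle : {homo f : x y / (x <= y)%O}) (H : topFunctor Q) :
    topFunctor P :=
  @TopFunctor d P (fun x => H (f x)) (fun x y xy => tmap H (fle x y xy))
    (fun x xx => tmap_id (fle x x xx))
    (fun x y z xy yz xz => tmap_comp (fle x y xy) (fle y z yz) (fle x z xz)).

Notation J R := ({posnum R}^d *p {posnum R})%type.
Notation Rop_R R := (R^d *p R)%type.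

Section interleavings.
Context {R : realType}.

Definition J_incl (p : J R) : Rop_R R :=
  ((p.1 : {posnum R})%:num, (p.2 : {posnum R})%:num).

Definition tau (delta : R) (x : Rop_R R) : Rop_R R :=
  ((x.1 : R) - delta, (x.2 : R) + delta).

Lemma J_leE (p q : J R) : (p <= q)%O =
  ((q.1 : {posnum R})%:num <= (p.1 : {posnum R})%:num :> R) &&
  ((p.2 : {posnum R})%:num <= (q.2 : {posnum R})%:num :> R).
Proof. by rewrite leEprod leEdual. Qed.

Lemma tau_leE (delta : R) (p q : J R) : (tau delta (J_incl p) <= J_incl q)%O =
  ((q.1 : {posnum R})%:num <= (p.1 : {posnum R})%:num - delta) &&
  ((p.2 : {posnum R})%:num + delta <= (q.2 : {posnum R})%:num).
Proof. by rewrite leEprod leEdual. Qed.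

(* The objects of I^delta; [false] and [true] are the indices 0 and 1.        *)
Definition ilv (delta : {nonneg R}) : Type := (J R * bool)%type.

Section ilv_preorder.
Variable delta : {nonneg R}.

Definition ilv_le : rel (ilv delta) := fun x y =>
  if x.2 == y.2 then (x.1 <= y.1)%O
  else (tau delta%:num (J_incl x.1) <= J_incl y.1)%O.

Lemma ilv_le_refl : reflexive ilv_le.
Proof. by move=> x; rewrite /ilv_le eqxx lexx. Qed.

Lemma ilv_le_trans : transitive ilv_le.
Proof.
have d0 : 0 <= delta%:num by [].
move=> [y j] [x i] [z k]; rewrite /ilv_le/= !tau_leE !J_leE.
by case: i j k => [] [] [] /= /andP[? ?] /andP[? ?]; apply/andP; split; lra.
Qed.

HB.instance Definition _ := Choice.copy (ilv delta) (J R * bool)%type.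
HB.instance Definition _ := Order.Le_isPreorder.Build ring_display (ilv delta)
  ilv_le_refl ilv_le_trans.

Definition ilv_in (i : bool) (p : J R) : ilv delta := (p, i).

Lemma ilv_in_le (i : bool) : {homo ilv_in i : p q / (p <= q)%O}.
Proof. by move=> p q pq; rewrite /Order.le/= /ilv_le eqxx. Qed.

End ilv_preorder.

Definition interleaved (delta : {nonneg R}) (F G : topFunctor (J R)) : Prop :=
  exists H : topFunctor (ilv delta),
    precomp (@ilv_in_le delta false) H = F /\
    precomp (@ilv_in_le delta true) H = G.

Definition d_I (F G : topFunctor (J R)) : \bar R :=
  ereal_inf [set (delta%:num)%:E | delta in
    [set delta : {nonneg R} | interleaved delta F G]].

End interleavings.

(* The fields are those of [isMeasure] on the sigma-algebra generated by the  *)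
(* open sets; {measure set _ -> \bar R} itself is only available on pointed   *)
(* types and would exclude the empty space. As for library measures, values   *)
(* outside the sigma-algebra carry no meaning.                                *)
Record borelMeasure (R : realType) (Z : topologicalType) := BorelMeasure {
  bmeas :> set Z -> \bar R ;
  bmeas0 : bmeas set0 = 0%E ;
  bmeas_ge0 : forall A, (0 <= bmeas A)%E ;
  bmeas_sigma_additive : forall A : (set Z)^nat,
    (forall i, <<s open >> (A i)) -> trivIset setT A ->
    (fun n => \sum_(0 <= i < n) bmeas (A i))%E @ \oo --> bmeas (\bigcup_n A n)
}.

Section borel_measure_of_point.
Context {R : realType} {Z : topologicalType} (z : Z).
Variable mu : borelMeasure R Z.

Definition pointed_at (_ : Z) : Type := Z.
HB.instance Definition _ := Topological.copy (pointed_at z) Z.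
HB.instance Definition _ := isPointed.Build (pointed_at z) z.

Definition borel_at := g_sigma_algebraType (@open (pointed_at z)).
HB.instance Definition _ := Measurable.on borel_at.

Definition bmeas_at : set borel_at -> \bar R := mu.

Lemma bmeas_at_semi_sigma_additive : semi_sigma_additive bmeas_at.
Proof. by move=> A mA tA _; exact: bmeas_sigma_additive. Qed.

HB.instance Definition _ := isMeasure.Build _ borel_at R bmeas_at
  (bmeas0 mu) (bmeas_ge0 mu) bmeas_at_semi_sigma_additive.

End borel_measure_of_point.

Lemma le_bmeas (R : realType) (Z : topologicalType) (mu : borelMeasure R Z)
    (A B : set Z) :
  <<s open >> A -> <<s open >> B -> A `<=` B -> (mu A <= mu B)%E.
Proof.
move=> mA mB AB; have [->|/set0P[z _]] := eqVneq A set0.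
  by rewrite bmeas0 bmeas_ge0.
by apply: (@le_measure _ _ _ (@bmeas_at R Z z mu)); rewrite ?inE.
Qed.

Lemma open_mball (R : realType) (Z : metricType R) (y : Z) (r : R) :
  open (ball y r).
Proof.
rewrite openE => x; rewrite ballEmdist/= => yx.
have e0 : 0 < r - mdist y x by rewrite subr_gt0.
apply/nbhs_ballP; exists (r - mdist y x) => //= z.
rewrite !ballEmdist/= => xz.
by rewrite (le_lt_trans (metric_triangle y x z))// addrC -ltrBrDr.
Qed.

Section measure_bifiltration.
Context {R : realType} {Z : metricType R}.

Definition bifiltration_set (mu : borelMeasure R Z) (p : J R) : set Z :=
  [set y | (((p.1 : {posnum R})%:num)%:E <=
            mu (ball y (p.2 : {posnum R})%:num))%E].

Variable mu : borelMeasure R Z.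

Lemma bifiltration_set_le (p q : J R) : (p <= q)%O ->
  bifiltration_set mu p `<=` bifiltration_set mu q.
Proof.
rewrite J_leE => /andP[k r] y /=; rewrite /bifiltration_set/= => ky.
apply: (le_trans (y := ((p.1 : {posnum R})%:num)%:E)); first by rewrite lee_fin.
apply: le_trans ky _; apply: le_bmeas.
- by apply: sub_gen_smallest; exact: open_mball.
- by apply: sub_gen_smallest; exact: open_mball.
- exact: le_ball.
Qed.

Section inclusion.
Variables (p q : J R) (pq : (p <= q)%O).

Definition bifiltration_incl
    (x : bifiltration_set mu p) : bifiltration_set mu q :=
  SigSub (mem_set (bifiltration_set_le pq (set_mem (valP x)))).

Lemma bifiltration_incl_continuous : continuous bifiltration_incl.
Proof.
by apply: continuous_comp_initial; exact: initial_continuous.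
Qed.

HB.instance Definition _ := isContinuous.Build _ _ bifiltration_incl
  bifiltration_incl_continuous.

End inclusion.

Lemma bifiltration_incl_id p (pp : (p <= p)%O) :
  bifiltration_incl pp =1 idfun.
Proof. by move=> x; exact: val_inj. Qed.

Lemma bifiltration_incl_comp p q s
    (pq : (p <= q)%O) (qs : (q <= s)%O) (ps : (p <= s)%O) :
  bifiltration_incl ps =1 bifiltration_incl qs \o bifiltration_incl pq.
Proof. by move=> x; exact: val_inj. Qed.

Definition bifiltration : topFunctor (J R) :=
  @TopFunctor _ (J R) (fun p => bifiltration_set mu p : topologicalType)
    (fun p q pq => bifiltration_incl pq)
    bifiltration_incl_id bifiltration_incl_comp.

End measure_bifiltration.

Section prohorov.
Context {R : realType} {Z : metricType R}.

Definition thickening (A : set Z) (delta : R) : set Z :=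
  [set y | exists2 a, A a & mdist y a < delta].

Definition d_Pr (mu eta : borelMeasure R Z) : \bar R :=
  ereal_sup [set ereal_inf [set (delta%:num)%:E | delta in
      [set delta : {nonneg R} |
        (mu A <= eta (thickening A delta%:num) + (delta%:num)%:E)%E /\
        (eta A <= mu (thickening A delta%:num) + (delta%:num)%:E)%E]]
    | A in [set A : set Z | closed A]].

End prohorov.

(* Main.v *)
(* If y lies in B(mu)_(k,r), compare mu and eta on the closed balls of radius *)
(* s < r about y: their delta-thickenings lie in B(y, r + delta), so          *)
(* eta(B(y, r + delta)) >= mu(B(y, r)) - delta by continuity from below.      *)
(* Hence B(mu)_p is contained in B(eta)_q whenever tau^delta(p) <= q, and     *)
(* these inclusions form a delta-interleaving.                                *)
Require Import Defs.
From HB Require Import structures.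
From mathcomp Require Import all_boot all_order all_algebra.
From mathcomp Require Import all_classical all_reals all_analysis.
From mathcomp Require Import lra.

Set Implicit Arguments.
Unset Strict Implicit.
Unset Printing Implicit Defensive.

Import Order.TTheory GRing.Theory Num.Theory.
Import numFieldNormedType.Exports.

Local Open Scope classical_set_scope.
Local Open Scope ring_scope.

(** Every [delta] above the Prohorov distance satisfies both measure inequalities for all closed
    sets simultaneously, since thickenings grow with their radius ([d_Pr_lt]). Closed balls then
    give the comparison of open balls in [bmeas_ball_thickening], hence the shifted inclusions of
    [bifiltration_set_shift] in both directions. All the spaces are subspaces of [Z] and all the
    maps are inclusions, so every diagram commutes and the two bifiltrations glue to one functor on
    [ilv delta] ([interleaved_bifiltration]). Letting [delta] decrease to the distance gives the
    bound. *)

Lemma topFunctor_ext d (P : preorderType d) (X : P -> topologicalType)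
    (f g : forall x y : P, (x <= y)%O -> continuousType (X x) (X y))
    f_id f_comp g_id g_comp :
  (forall x y (xy : (x <= y)%O), f x y xy =1 g x y xy) ->
  TopFunctor (tmap := f) f_id f_comp = TopFunctor (tmap := g) g_id g_comp.
Proof.
move=> fg; have {}fg : f = g.
  apply: functional_extensionality_dep => x.
  apply: functional_extensionality_dep => y.
  apply: functional_extensionality_dep => xy.
  exact/continuousEP.
(* Once the maps coincide, the functors differ only in the proofs of the functor laws. *)
by case: _ / fg in g_id g_comp *; congr TopFunctor; exact: Prop_irrelevance.
Qed.

Section subspace_functor.
Context d (P : preorderType d) (Z : topologicalType) (S : P -> set Z).
Hypothesis S_le : forall p q : P, (p <= q)%O -> S p `<=` S q.

Section inclusion.
Variables (p q : P) (pq : (p <= q)%O).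

Definition subspace_incl (x : S p) : S q :=
  SigSub (mem_set (S_le pq (set_mem (valP x)))).

Lemma subspace_incl_continuous : continuous subspace_incl.
Proof. by apply: continuous_comp_initial; exact: initial_continuous. Qed.

HB.instance Definition _ := isContinuous.Build _ _ subspace_incl
  subspace_incl_continuous.

End inclusion.

Lemma subspace_incl_id p (pp : (p <= p)%O) : subspace_incl pp =1 idfun.
Proof. by move=> x; exact: val_inj. Qed.

Lemma subspace_incl_comp p q s
    (pq : (p <= q)%O) (qs : (q <= s)%O) (ps : (p <= s)%O) :
  subspace_incl ps =1 subspace_incl qs \o subspace_incl pq.
Proof. by move=> x; exact: val_inj. Qed.

(** The construction of [bifiltration] over an arbitrary preorder: on [ilv delta], a monotone family
    of subsets is already an interleaving. *)
Definition subspace_functor : topFunctor P :=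
  @TopFunctor _ P (fun p => S p : topologicalType)
    (fun p q pq => subspace_incl pq) subspace_incl_id subspace_incl_comp.

End subspace_functor.

Section measure_comparison.
Context {R : realType} {Z : metricType R}.

Definition closed_mball (y : Z) (r : R) : set Z := [set z | mdist y z <= r].

Lemma closed_closed_mball (y : Z) (r : R) : closed (closed_mball y r).
Proof.
rewrite -openC openE => x /= /negP; rewrite -ltNge => rx.
apply/nbhs_ballP; exists (mdist y x - r) => /=; first by rewrite subr_gt0.
move=> z; rewrite ballEmdist/= => xz; apply/negP; rewrite -ltNge.
have := metric_triangle y z x; rewrite (metric_sym z x); lra.
Qed.

Lemma measurable_closed (A : set Z) : closed A -> <<s open >> A.
Proof.
rewrite -openC => oA; rewrite -(setCK A) -setTD.
by apply: sigma_algebraCD; exact: sub_gen_smallest.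
Qed.

Lemma thickening_bigcup (A : set Z) (delta : R) :
  thickening A delta = \bigcup_(a in A) ball a delta.
Proof.
apply/seteqP; split=> z [a Aa az]; exists a => //=;
  by move: az; rewrite ballEmdist/= metric_sym.
Qed.

Lemma open_thickening (A : set Z) (delta : R) : open (thickening A delta).
Proof.
by rewrite thickening_bigcup; apply: bigcup_open => a _; exact: open_mball.
Qed.

Lemma le_thickening (A : set Z) (d e : R) : d <= e ->
  thickening A d `<=` thickening A e.
Proof. by move=> de y [a Aa ya]; exists a => //; exact: lt_le_trans de. Qed.

Lemma bigcup_closed_mball (y : Z) (r : R) :
  \bigcup_n closed_mball y (r - n.+1%:R^-1) = ball y r.
Proof.
rewrite ballEmdist; apply/seteqP; split=> z /=.
  move=> [n _] yz; rewrite (le_lt_trans yz)// ltrBlDr ltrDl.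
  by rewrite invr_gt0 ltr0n.
rewrite -subr_gt0 => yz; have [N _ /(_ N (leqnn _))/= Nr] :=
  near_infty_natSinv_lt (PosNum yz).
by exists N => //; rewrite /closed_mball/= lerBrDl -lerBrDr ltW.
Qed.

(** Continuity from below along the closed balls of radius [r - 1/(n+1)], which exhaust the open
    ball. *)
Lemma bmeas_ball_le (mu : borelMeasure R Z) (y : Z) (r : R) (c : \bar R) :
  (forall s, s < r -> (mu (closed_mball y s) <= c)%E) ->
  (mu (ball y r) <= c)%E.
Proof.
move=> muc; set F := fun n => closed_mball y (r - n.+1%:R^-1).
have mF n : <<s open >> (F n).
  by apply: measurable_closed; exact: closed_closed_mball.
have : (mu \o F) @ \oo --> mu (\bigcup_n F n).
  (* The centre [y] serves as the base point that turns [Z] into a measurable type. *)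
  have := @nondecreasing_cvg_mu _ (borel_at y) R (@bmeas_at R Z y mu) F mF.
  apply => //.
    rewrite bigcup_closed_mball.
    by apply: sub_gen_smallest; exact: open_mball.
  move=> m n mn; apply/subsetPset => z; rewrite /F/closed_mball/= => yz.
  by rewrite (le_trans yz)// lerB// lef_pV2 ?posrE ?ltr0n// ler_nat.
rewrite bigcup_closed_mball => Fr.
rewrite -(cvg_lim (@ereal_hausdorff R) Fr); apply: lime_le.
  by apply/cvg_ex; eexists; exact: Fr.
apply: nearW => n; apply: muc.
by rewrite ltrBlDr ltrDl invr_gt0 ltr0n.
Qed.

Lemma bmeas_ball_thickening (mu eta : borelMeasure R Z) (delta : R) :
  (forall A, closed A -> (mu A <= eta (thickening A delta) + delta%:E)%E) ->
  forall y r, (mu (ball y r) <= eta (ball y (r + delta)) + delta%:E)%E.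
Proof.
move=> mueta y r; apply: bmeas_ball_le => s sr.
apply: (le_trans (mueta _ (@closed_closed_mball y s))).
rewrite leeD2r//; apply: le_bmeas.
- by apply: sub_gen_smallest; exact: open_thickening.
- by apply: sub_gen_smallest; exact: open_mball.
(* Triangle inequality through [a]: the distance from [y] to [z] is below [s + delta], hence below
   [r + delta]. *)
- move=> z [a]; rewrite /closed_mball/= ballEmdist/= => ya za.
  by have := metric_triangle y a z; rewrite (metric_sym a z); lra.
Qed.

Lemma bifiltration_set_shift (mu eta : borelMeasure R Z) (delta : R)
    (p q : J R) :
  (forall A, closed A -> (mu A <= eta (thickening A delta) + delta%:E)%E) ->
  (tau delta (J_incl p) <= J_incl q)%O ->
  bifiltration_set mu p `<=` bifiltration_set eta q.
Proof.
move=> mueta; rewrite tau_leE => /andP[k r] y; rewrite /bifiltration_set/= => py.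
have pE : (((p.1 : {posnum R})%:num - delta)%:E <=
    eta (ball y ((p.2 : {posnum R})%:num + delta)))%E.
  rewrite EFinB leeBlDr//.
  exact: le_trans py (bmeas_ball_thickening mueta _ _).
apply: (le_trans _ (le_trans pE _)); first by rewrite lee_fin.
apply: le_bmeas; last exact: le_ball.
- by apply: sub_gen_smallest; exact: open_mball.
- by apply: sub_gen_smallest; exact: open_mball.
Qed.

Lemma interleaved_bifiltration (mu eta : borelMeasure R Z) (delta : {nonneg R}) :
  (forall A, closed A ->
    (mu A <= eta (thickening A delta%:num) + (delta%:num)%:E)%E /\
    (eta A <= mu (thickening A delta%:num) + (delta%:num)%:E)%E) ->
  interleaved delta (bifiltration mu) (bifiltration eta).
Proof.
move=> mueta.
pose S (x : ilv delta) := bifiltration_set (if x.2 then eta else mu) x.1.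
have S_le (x y : ilv delta) : (x <= y)%O -> S x `<=` S y.
  case: x y => [p i] [q j]; rewrite /Order.le/= /ilv_le/= /S/=.
  case: i j => [] [] /= pq.
  - exact: bifiltration_set_le.
  - by apply: bifiltration_set_shift pq => A /mueta[].
  - by apply: bifiltration_set_shift pq => A /mueta[].
  - exact: bifiltration_set_le.
exists (subspace_functor S_le).
(* [interleaved] asks for equal functors: the spaces agree by computation, and the maps agree
   because they fix the underlying point of [Z]. *)
by split; apply: topFunctor_ext => p q pq x; exact: val_inj.
Qed.

(** The infimum for [A] lies below [delta], so some [e < delta], depending on [A], is admissible;
    enlarging it to [delta] removes this dependence. *)
Lemma d_Pr_lt (mu eta : borelMeasure R Z) (delta : R) (A : set Z) :
  (d_Pr mu eta < delta%:E)%E -> closed A ->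
  (mu A <= eta (thickening A delta) + delta%:E)%E /\
  (eta A <= mu (thickening A delta) + delta%:E)%E.
Proof.
move=> ltd cA.
have /ereal_inf_lt[_ [e [muA etaA] <-]] : (ereal_inf [set (delta%:num)%:E | delta in
    [set delta : {nonneg R} |
      (mu A <= eta (thickening A delta%:num) + (delta%:num)%:E)%E /\
      (eta A <= mu (thickening A delta%:num) + (delta%:num)%:E)%E]] < delta%:E)%E.
  by apply: le_lt_trans ltd; apply: ereal_sup_ubound; exists A.
rewrite lte_fin => /ltW ed.
have thick (nu : borelMeasure R Z) :
    (nu (thickening A e%:num) + (e%:num)%:E <=
     nu (thickening A delta) + delta%:E)%E.
  apply: leeD; last by rewrite lee_fin.
  apply: le_bmeas; last exact: le_thickening.
  - by apply: sub_gen_smallest; exact: open_thickening.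
  - by apply: sub_gen_smallest; exact: open_thickening.
by split; [exact: le_trans muA (thick _)|exact: le_trans etaA (thick _)].
Qed.

(** The closed set [set0] already contributes a nonnegative infimum; this excludes the value [-oo]
    and makes [r + e] a legitimate shift in the theorem. *)
Lemma d_Pr_ge0 (mu eta : borelMeasure R Z) : (0 <= d_Pr mu eta)%E.
Proof.
apply: (@le_trans _ _ (ereal_inf [set (delta%:num)%:E | delta in
    [set delta : {nonneg R} |
      (mu set0 <= eta (thickening set0 delta%:num) + (delta%:num)%:E)%E /\
      (eta set0 <= mu (thickening set0 delta%:num) + (delta%:num)%:E)%E]])).
  by apply: le_ereal_inf_tmp => _ [e _ <-]; rewrite lee_fin.
by apply: ereal_sup_ubound; exists set0 => //; exact: closed0.
Qed.

End measure_comparison.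

Theorem theorem3p1 (R : realType) (Z : metricType R) (mu eta : borelMeasure R Z) :
  (d_I (bifiltration mu) (bifiltration eta) <= d_Pr mu eta)%E.
Proof.
have := d_Pr_ge0 mu eta; case dE : (d_Pr mu eta) => [r| |] //.
  (* A margin [e > 0] is added because [d_Pr_lt] needs a shift strictly above the distance. *)
  rewrite lee_fin => r0; apply/lee_addgt0Pr => e e0.
  have re0 : 0 <= r + e by rewrite addr_ge0// ltW.
  apply: ereal_inf_lbound; exists (NngNum re0) => //.
  apply: interleaved_bifiltration => A; apply: d_Pr_lt.
  by rewrite dE lte_fin/= ltrDl.
by move=> _; rewrite leey.
Qed.
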